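(* Let $S$ be a Seidel matrix of order $n$ with precisely three distinct eigenvalues $\lambda$, $\mu$, and $\nu$. Suppose that $S$ has a $k$-regular graph $\Gamma$ in its switching class. Then, for every vertex $v \in V(\Gamma)$, the number of triangles of $\Gamma$ containing $v$ (that is, closed $3$-walks from $v$ counted up to reversal of direction) is $$\frac{(n-1)(n-2)-6k(n-2k) - (\lambda+\mu+\nu)(n-1)-\lambda\mu\nu}{16}.$$ Moreover, $k = (n-1-\theta)/2$ for some $\theta \in \{\lambda,\mu,\nu\}$.
   Context: A Seidel matrix is a symmetric $\{0,\pm1\}$-matrix with zero diagonal and all off-diagonal entries nonzero. Two integer matrices $X,Y$ of order $n$ are switching equivalent if $X=P^{\top}YP$ for some signed permutation matrix $P$. The underlying graph of a Seidel matrix $S$ is the graph with adjacency matrix $(J-I-S)/2$, where $J$ is the all-ones matrix and $I$ the identity matrix. The switching class of $S$ is the set of underlying graphs of Seidel matrices that are switching equivalent to $S$. A graph is $k$-regular if all its vertices have valency $k$. *)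

(* Defs.v *)
From HB Require Import structures.
From mathcomp Require Import all_boot all_order all_algebra all_fingroup.

Set Implicit Arguments.
Unset Strict Implicit.
Unset Printing Implicit Defensive.

Import Order.TTheory GRing.Theory Num.Theory.
Local Open Scope ring_scope.

Record sgraph (V : finType) := SGraph {
  edge :> rel V;
  edge_sym : symmetric edge;
  edge_irrefl : irreflexive edge
}.

Section Graphs.
Variable V : finType.
Implicit Types (G : sgraph V) (v : V).

Definition valency G v : nat := #|[set w | edge G v w]|.

Definition regular_graph (k : nat) G : Prop := forall v, valency G v = k.

(* A triangle is identified with its set of three vertices; the closed 3-walks
   v, a, b, v up to reversal correspond to the triangles {v, a, b}. *)
Definition is_triangle G (t : {set V}) : bool :=
  (#|t| == 3) && [forall x in t, forall y in t, (x != y) ==> edge G x y].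

Definition triangles_at G v : nat :=
  #|[set t : {set V} | is_triangle G t && (v \in t)]|.

End Graphs.

Section Seidel.
Variable n : nat.
Implicit Types (S T X Y P : 'M[int]_n) (G : sgraph 'I_n).

Definition is_seidel S : Prop :=
  [/\ S^T = S,
      forall i j, S i j \in [:: 0; 1; -1],
      forall i, S i i = 0
    & forall i j, i != j -> S i j != 0].

(* P is {0, 1, -1}-valued with exactly one nonzero entry in each row and each
   column: taking absolute values entrywise gives a permutation matrix. *)
Definition is_signed_perm_mx P : bool := is_perm_mx (map_mx Num.norm P).

Definition switching_equiv X Y : Prop :=
  exists P : 'M[int]_n, is_signed_perm_mx P /\ X = P^T *m Y *m P.

Definition adjacency_mx G : 'M[int]_n := \matrix_(i, j) (edge G i j)%:R.

(* Adjacency matrix equal to (J - I - S) / 2, with the division by 2 cleared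
   so that the equation lives over int. *)
Definition is_underlying_graph S G : Prop :=
  2 *: adjacency_mx G = const_mx 1 - 1%:M - S.

Definition in_switching_class S G : Prop :=
  exists T : 'M[int]_n,
    [/\ is_seidel T, switching_equiv T S & is_underlying_graph T G].

End Seidel.

(* Main.v *)
Require Import Defs.
From HB Require Import structures.
From mathcomp Require Import all_boot all_order all_algebra all_fingroup.
From mathcomp Require Import ring.

Set Implicit Arguments.
Unset Strict Implicit.
Unset Printing Implicit Defensive.

Import Order.TTheory GRing.Theory Num.Theory.
Local Open Scope ring_scope.

(** The Seidel matrix T = J - I - 2A of Gamma is symmetric with its eigenvalues
    among those of S, so it is annihilated by p = (X - lambda)(X - mu)(X - nu).
    As A J = J A = k J, the all-ones vector is an eigenvector of T for
    n - 1 - 2k, which is thus a root of p. Expanding the powers of J - (I + 2A),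
    the entries (v, v) of T, T^2 and T^3 are 0, n - 1 and an expression affine
    in (A^3)_vv, twice the number of triangles at v; the entry (v, v) of
    p(T) = 0 then yields the number of triangles. *)

(** * Polynomials evaluated at a matrix *)

Lemma mulmx_horner_mx (R : comNzRingType) (n : nat) (A : 'M[R]_n.+1)
    (u : 'rV_n.+1) (a : R) (p : {poly R}) :
  u *m A = a *: u -> u *m horner_mx A p = p.[a] *: u.
Proof.
move=> uA; elim/poly_ind: p => [|p c IHp].
  by rewrite raddf0 mulmx0 horner0 scale0r.
rewrite rmorphD rmorphM /= horner_mx_X horner_mx_C mulmxDr mulmxA IHp.
by rewrite -scalemxAl uA scalerA mul_mx_scalar hornerMXaddC scalerDl.
Qed.

(** By the spectral theorem the rows of an invertible matrix [U] are left eigenvectors of [A], and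
    [p] evaluated at [A] kills each of them. *)
Lemma horner_mx_normal (C : numClosedFieldType) (n : nat) (A : 'M[C]_n.+1)
    (p : {poly C}) :
    A \is normalmx -> (forall a, eigenvalue A a -> root p a) ->
  horner_mx A p = 0.
Proof.
move=> /orthomx_spectralP; set U := spectralmx A; set d := spectral_diag A.
have Uunit : U \in unitmx by apply: spectral_unit.
move=> defA pA.
have UA : U *m A = diag_mx d *m U by rewrite {1}defA !mulmxA mulmxV // mul1mx.
have rowUA i : row i U *m A = d 0 i *: row i U.
  by rewrite -row_mul UA row_mul row_diag_mx -scalemxAl -rowE.
suff Up0 : U *m horner_mx A p = 0.
  by rewrite -[LHS]mul1mx -(mulVmx Uunit) -mulmxA Up0 mulmx0.
apply/row_matrixP => i; rewrite row_mul (mulmx_horner_mx _ (rowUA i)) row0.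
suff /pA/rootP-> : eigenvalue A (d 0 i) by rewrite scale0r.
apply/eigenvalueP; exists (row i U) => //.
(* A zero row would make the determinant of [U] vanish. *)
apply: contraTneq Uunit => rowi0.
by rewrite unitmxE (expand_det_row U i) big1 ?unitr0 // => j _;
  move/rowP/(_ j): rowi0; rewrite !mxE => ->; rewrite mul0r.
Qed.

Lemma horner_mx_cubic (R : comNzRingType) (n : nat) (A : 'M[R]_n.+1)
    (a b c : R) :
  horner_mx A ('X^3 - a *: 'X^2 + b *: 'X - c%:P) =
    A ^+ 3 - a *: A ^+ 2 + b *: A - c%:M.
Proof.
by rewrite rmorphB rmorphD rmorphB /= !horner_mxZ !rmorphXn /= horner_mx_X
           horner_mx_C.
Qed.

(** * Switching and eigenvalues *)

(** Row [i] of [P] has a single nonzero entry, of absolute value 1, in column [s i]; distinct rows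
    have disjoint supports because [s] is injective. *)
Lemma signed_perm_mx_mul_tr (n : nat) (P : 'M[int]_n) :
  is_signed_perm_mx P -> P *m P^T = 1%:M.
Proof.
case/is_perm_mxP => s defP.
have normP i j : `|P i j| = (s i == j)%:R.
  by move/matrixP/(_ i j): defP; rewrite !mxE.
apply/matrixP => i j; rewrite !mxE (bigD1 (s i)) //= big1 ?addr0 => [|l ne_l].
  rewrite mxE; have [->|ne_ij] := eqVneq i j.
    by rewrite -expr2 -real_normK ?num_real // normP eqxx expr1n.
  suff /eqP-> : P j (s i) == 0 by rewrite mulr0.
  by rewrite -normr_eq0 normP (inj_eq perm_inj) pnatr_eq0 eqb0 eq_sym.
suff /eqP-> : P i l == 0 by rewrite mul0r.
by rewrite -normr_eq0 normP pnatr_eq0 eqb0 eq_sym.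
Qed.

(** As [P] is orthogonal, multiplication by its transpose carries left eigenvectors of [T]
    injectively to left eigenvectors of [S]. *)
Lemma eigenvalue_switching (F : fieldType) (n : nat) (S T : 'M[int]_n) (a : F) :
    switching_equiv T S -> eigenvalue (map_mx intr T) a ->
  eigenvalue (map_mx intr S) a.
Proof.
case=> P [/signed_perm_mx_mul_tr PPt ->] /eigenvalueP[v vT v_neq0].
pose Q : 'M[F]_n := map_mx intr P.
have QQt : Q *m Q^T = 1%:M by rewrite map_trmx -map_mxM PPt map_mx1.
apply/eigenvalueP; exists (v *m Q^T).
  move: vT; rewrite !map_mxM -map_trmx -/Q => /(congr1 (mulmx^~ Q^T)).
  by rewrite !mulmxA -[_ *m Q *m _]mulmxA QQt mulmx1 -scalemxAl.
apply: contra_neq v_neq0 => vQt0.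
by rewrite -[v]mulmx1 -(mulmx1C QQt) mulmxA vQt0 mul0mx.
Qed.

(** * Triangles and closed 3-walks *)

Section ClosedWalks.
Variables (V : finType) (G : sgraph V) (v : V).

(** A walk is recorded by its two inner vertices, so the two directions around a triangle are
    distinct elements. *)
Definition closed_3walks : {set V * V} :=
  [set w | [&& edge G v w.1, edge G w.1 w.2 & edge G w.2 v]].

Lemma edge_neq (x y : V) : edge G x y -> x != y.
Proof. by apply: contraTneq => ->; rewrite edge_irrefl. Qed.

Lemma is_triangle3 (x y z : V) :
    edge G x y -> edge G y z -> edge G z x -> is_triangle G [set x; y; z].
Proof.
move=> xy yz zx; apply/andP; split.
  have [[nxy nyz] nzx] := (edge_neq xy, edge_neq yz, edge_neq zx).
  by rewrite setUC cardsU1 cards2 !inE negb_or nxy nzx [z == y]eq_sym nyz.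
apply/forall_inP => a; rewrite !inE => /orP[/orP[]|] /eqP->;
  apply/forall_inP => b; rewrite !inE => /orP[/orP[]|] /eqP->;
  rewrite ?eqxx ?xy ?yz ?zx ?implybT //.
all: by rewrite edge_sym ?xy ?yz ?zx implybT.
Qed.

Lemma card_closed_3walks : #|closed_3walks| = (triangles_at G v * 2)%N.
Proof.
pose f (w : V * V) := [set v; w.1; w.2].
rewrite -sum1_card (partition_big f
  (fun t => t \in [set t : {set V} | is_triangle G t && (v \in t)])) /=; last first.
  move=> [a b]; rewrite !inE /= eqxx /= => /and3P[va ab bv].
  by rewrite is_triangle3.
rewrite -sum_nat_const; apply: eq_bigr => t; rewrite inE => /andP[tri vt].
have {tri}[/eqP card_t /forall_inP tri] := andP tri.
have /cards2P[x [y [nxy def_t]]] : #|t :\ v| == 2.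
  by move: card_t; rewrite (cardsD1 v) vt => /eqP.
have /setD1P[nxv xt] : x \in t :\ v by rewrite def_t set21.
have /setD1P[nyv yt] : y \in t :\ v by rewrite def_t set22.
have {}def_t : t = [set v; x; y] by rewrite -setUA -def_t setD1K.
have edge_t a b : a \in t -> b \in t -> a != b -> edge G a b.
  by move=> ta tb nab; apply: (implyP (forall_inP (tri a ta) b tb)).
rewrite -[in RHS](_ : #|[set (x, y); (y, x)]| = 2%N); last first.
  by rewrite cards2 xpair_eqE negb_and nxy.
rewrite sum1dep_card; apply: eq_card => -[a b]; rewrite !inE /= !xpair_eqE.
apply/andP/orP => [[/and3P[va ab bv] /eqP fab]|].
  have at_ : a \in [set v; x; y] by rewrite -def_t -fab !inE eqxx orbT.
  have bt_ : b \in [set v; x; y] by rewrite -def_t -fab !inE eqxx orbT.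
  (* Both inner vertices differ from [v] and from each other, which leaves only the two orderings of
     [x] and [y]. *)
  move: at_ bt_ (edge_neq va) (edge_neq ab) (edge_neq bv).
  rewrite !inE [v == a]eq_sym.
  have [->|_] := eqVneq a v; first by [].
  have [->|_] := eqVneq b v; first by [].
  move=> /= /orP[]/eqP-> /orP[]/eqP->; rewrite ?eqxx //; by [left | right].
case=> /andP[/eqP-> /eqP->]; (split; last by
  apply/eqP; rewrite def_t /f /= -!setUA //; congr (_ :|: _); rewrite setUC).
  by rewrite !edge_t // eq_sym.
by rewrite !edge_t // eq_sym.
Qed.

End ClosedWalks.

(** * Powers of the Seidel matrix of a regular graph *)

Section RegularGraph.
Variables (R : comNzRingType) (n k : nat) (G : sgraph 'I_n.+1).
Hypothesis regG : regular_graph k G.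

Let J : 'M[R]_n.+1 := const_mx 1.
Let A : 'M[R]_n.+1 := map_mx intr (adjacency_mx G).
(** The order is [n.+1], so [n%:R] below is the order minus one. *)
Let T := J - 1 - 2 *: A.

Let A_E i j : A i j = (edge G i j)%:R.
Proof. by rewrite !mxE mulrz_nat. Qed.

Let sumA i : \sum_j (A i j) = k%:R.
Proof.
under eq_bigr do rewrite A_E.
rewrite -(regG i) /valency -sum1dep_card natr_sum [RHS]big_mkcond /=.
by apply: eq_bigr => j _; case: edge.
Qed.

Let A_C i j : A i j = A j i.
Proof. by rewrite !A_E edge_sym. Qed.

Let mulAJ : A * J = k%:R *: J.
Proof.
apply/matrixP => i j; rewrite !mxE -(sumA i) mulr1.
by apply: eq_bigr => l _; rewrite !mxE mulr1.
Qed.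

Let mulJA : J * A = k%:R *: J.
Proof.
apply/matrixP => i j; rewrite !mxE -(sumA j) mulr1.
by apply: eq_bigr => l _; rewrite [J _ _]mxE mul1r A_C.
Qed.

Let mulJJ : J * J = n.+1%:R *: J.
Proof.
apply/matrixP => i j; rewrite !mxE mulr1.
under eq_bigr do rewrite !mxE mulr1.
by rewrite sumr_const card_ord.
Qed.

Let diagA i : A i i = 0.
Proof. by rewrite A_E edge_irrefl. Qed.

Let diagA2 i : (A ^+ 2) i i = k%:R.
Proof.
rewrite expr2 mxE -(sumA i); apply: eq_bigr => j _.
by rewrite [A j i]A_C A_E; case: edge; rewrite ?mulr1 ?mulr0.
Qed.

Let diagA3 i : (A ^+ 3) i i = (2 * triangles_at G i)%:R.
Proof.
rewrite mulnC -card_closed_3walks -sum1dep_card natr_sum [RHS]big_mkcond /=.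
rewrite -(pair_bigA _ (fun a b => if [&& edge G i a, edge G a b & edge G b i]
  then 1%:R else 0 : R)) /=.
rewrite exprS mxE; apply: eq_bigr => a _.
rewrite expr2 [(A * A) _ _]mxE mulr_sumr; apply: eq_bigr => b _.
by rewrite !A_E -!natrM !mulnb; case: ifP.
Qed.

Lemma diag_seidel i : T i i = 0.
Proof. by rewrite !mxE edge_irrefl eqxx mulr0 subr0 subrr. Qed.

Let mulTJ : T * J = (n%:R - 2 * k%:R) *: J.
Proof.
rewrite !mulrBl mulJJ mul1r -scalerAl mulAJ scalerA -{2}[J]scale1r -!scalerBl.
by congr (_ *: _); rewrite -natr1; ring.
Qed.

(** Multiplying [J] by [N] only rescales [J], so each power of [T] is a multiple of [J] plus or
    minus the same power of [N]. *)
Let N := 1 + 2 *: A.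

Let defT : T = J - N.
Proof. by rewrite /T /N opprD addrA. Qed.

Let mulJN : J * N = (1 + 2 * k%:R) *: J.
Proof. by rewrite mulrDr mulr1 -scalerAr mulJA scalerA scalerDl scale1r. Qed.

Let T2 : T ^+ 2 = (n%:R - 1 - 4 * k%:R) *: J + N ^+ 2.
Proof.
rewrite expr2 {2}defT mulrBr mulTJ {1}defT mulrBl mulJN -expr2 opprB addrA.
rewrite addrAC -scalerBl; congr (_ *: _ + _); ring.
Qed.

Let T3 : T ^+ 3 = ((n%:R - 1 - 4 * k%:R) * (n%:R - 2 * k%:R)
   + (1 + 2 * k%:R) ^+ 2) *: J - N ^+ 3.
Proof.
rewrite exprS T2 mulrDr -scalerAr mulTJ scalerA {1}defT [(J - N) * _]mulrBl.
rewrite -exprS [in J * _]expr2 mulrA mulJN -scalerAl mulJN scalerA addrA -scalerDl.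
by rewrite -expr2.
Qed.

Let N2 : N ^+ 2 = 4 *: A ^+ 2 + 4 *: A + 1.
Proof. by rewrite /N addrC sqrrD1 exprZn -natrX scalerMnl -mulrnA. Qed.

Let N3 : N ^+ 3 = 1 + 6 *: A + 12 *: A ^+ 2 + 8 *: A ^+ 3.
Proof.
rewrite /N addrC exprD1n !big_ord_recr big_ord0 /= add0r expr0 mulr1n expr1.
by rewrite !exprZn -!natrX !scalerMnl -!mulrnA.
Qed.

Let entryD (X Y : 'M[R]_n.+1) i j : (X + Y) i j = X i j + Y i j.
Proof. by rewrite mxE. Qed.

Let entryB (X Y : 'M[R]_n.+1) i j : (X - Y) i j = X i j - Y i j.
Proof. by rewrite !mxE. Qed.

Let entryZ a (X : 'M[R]_n.+1) i j : (a *: X) i j = a * X i j.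
Proof. by rewrite mxE. Qed.

Let entry1 i : (1 : 'M[R]_n.+1) i i = 1.
Proof. by rewrite mxE eqxx. Qed.

Let entryJ i j : J i j = 1.
Proof. by rewrite mxE. Qed.

Lemma diag_seidel2 i : (T ^+ 2) i i = n%:R.
Proof.
rewrite T2 N2 !(entryD, entryZ, entryJ, entry1) diagA diagA2; ring.
Qed.

(** The only diagonal entry not fixed by [n] and [k] is that of [A ^+ 3], twice the triangle count;
    its coefficient 8 in [N ^+ 3] produces the 16. *)
Lemma diag_seidel3 i : (T ^+ 3) i i =
  n%:R * (n%:R - 1) - 6 * k%:R * (n.+1%:R - 2 * k%:R)
    - 16 * (triangles_at G i)%:R.
Proof.
rewrite T3 N3 entryB !(entryD, entryZ, entryJ, entry1) diagA diagA2 diagA3.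
by rewrite natrM -natr1; ring.
Qed.

Lemma const_mx_seidel :
  const_mx 1 *m T = (n%:R - 2 * k%:R) *: (const_mx 1 : 'rV[R]_n.+1).
Proof.
have -> : const_mx 1 = row 0 J by apply/rowP => j; rewrite !mxE.
rewrite -row_mul mulmxE !mulrBr mulJJ mulr1 -scalerAr mulJA scalerA.
by rewrite -{2}[J]scale1r -!scalerBl linearZ -natr1 addrK.
Qed.

End RegularGraph.

Theorem corollary3p4 (C : numClosedFieldType) (n k : nat) (S : 'M[int]_n)
    (lambda mu nu : C) (Gamma : sgraph 'I_n)
    (seidelS : is_seidel S)
    (distinct_eigenvalues : uniq [:: lambda; mu; nu])
    (eigenvaluesS : forall x : C,
       eigenvalue (map_mx intr S) x = (x \in [:: lambda; mu; nu]))
    (switchGamma : in_switching_class S Gamma)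
    (regularGamma : regular_graph k Gamma) :
  (forall v : 'I_n,
     (triangles_at Gamma v)%:R =
       ((n%:R - 1) * (n%:R - 2) - 6 * k%:R * (n%:R - 2 * k%:R)
        - (lambda + mu + nu) * (n%:R - 1) - lambda * mu * nu) / 16 :> C) /\
  (exists2 theta : C, theta \in [:: lambda; mu; nu]
     & k%:R = (n%:R - 1 - theta) / 2).
Proof.
case: n => [|n] in S Gamma seidelS eigenvaluesS switchGamma regularGamma *.
  (* In order zero there is no nonzero vector, hence no eigenvalue [lambda]. *)
  have /eigenvalueP[v _] : eigenvalue (map_mx intr S) lambda.
    by rewrite eigenvaluesS mem_head.
  by rewrite thinmx0 eqxx.
have [T [[symT _ _ _] swT defA]] := switchGamma.
pose TC : 'M[C]_n.+1 := map_mx intr T.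
have defTC : TC = const_mx 1 - 1 - 2 *: map_mx intr (adjacency_mx Gamma).
  apply/matrixP => i j; move/matrixP/(_ i j)/(congr1 (intr : int -> C)): defA.
  rewrite !mxE !(rmorphB, rmorphM, rmorph_nat) /= => ->.
  by rewrite subKr.
(* A symmetric integer matrix is Hermitian, hence normal. *)
have normT : TC \is normalmx.
  apply/normalmxP; suff -> : map_mx Num.conj TC^T = TC by [].
  apply/matrixP => i j; rewrite !mxE -[in RHS]symT mxE; exact: rmorph_int.
pose p : {poly C} := ('X - lambda%:P) * ('X - mu%:P) * ('X - nu%:P).
have rootp a : root p a = (a \in [:: lambda; mu; nu]).
  by rewrite !rootM !root_XsubC !inE orbA.
have pT0 : horner_mx TC p = 0.
  apply: horner_mx_normal => // a /(eigenvalue_switching swT).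
  by rewrite eigenvaluesS rootp.
split=> [v|].
  pose e1 := lambda + mu + nu.
  pose e2 := lambda * mu + lambda * nu + mu * nu.
  have defp : p = 'X^3 - e1 *: 'X^2 + e2 *: 'X - (lambda * mu * nu)%:P.
    by rewrite -!mul_polyC /p /e1 /e2 !polyCD !polyCM; ring.
  have d1 := diag_seidel C Gamma v.
  have d2 := diag_seidel2 C regularGamma v.
  have d3 := diag_seidel3 C regularGamma v.
  move/matrixP/(_ v v): pT0.
  rewrite defp horner_mx_cubic.
  rewrite -defTC in d1 d2 d3.
  (* Generalizing the powers keeps [mxE] from expanding them into sums. *)
  move: TC (TC ^+ 2) (TC ^+ 3) d1 d2 d3 {defp defTC normT} => X1 X2 X3 d1 d2 d3.
  rewrite !mxE d1 d2 d3 eqxx mulr1n => eq0.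
  apply: (canRL (mulfK _)); first by rewrite pnatr_eq0.
  (* Adding the vanishing diagonal entry cancels the triangle count; the [e2] term is multiplied by
     the zero diagonal of [T]. *)
  by rewrite -[LHS]addr0 -eq0 /e1 -[n.+1%:R]natr1; ring.
(* The eigenvalue of the all-ones vector, with [n.+1] now the order. *)
exists (n%:R - 2 * k%:R); last first.
  by rewrite -natr1; field.
rewrite -rootp; apply/rootP.
have := mulmx_horner_mx p (const_mx_seidel C regularGamma).
rewrite -defTC pT0 mulmx0 => /matrixP/(_ ord0 ord0).
by rewrite !mxE mulr1.
Qed.
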